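(* Let $\mathbb{F}$ be an algebraically closed field, let $n$ be a positive integer, and let $M\in\mathcal{M}_n$. Then an arbitrary multiset $\{n_1,\ldots,n_k\}\in\mathcal{P}(n)$ belongs to $\mathcal{P}_M$ if and only if $\{n_i\}\in\mathcal{P}_M$ for every $i=1,\ldots,k$.
   Context: Let $A=M_n(\mathbb{F})$ and let $A_n\subseteq A$ be the set of nilpotent matrices. $\mathcal{M}_n$ denotes the family of all subsets $M\subseteq A_n$ such that: (i) $0\in M$; (ii) $gMg^{-1}=M$ for every invertible $g\in A$; (iii) for all $X,Y\in M$ with $XY=YX$, the linear span $\langle X,Y\rangle$ is contained in $M$. $\mathcal{P}(n)$ is the set of all finite multisets (multiplicities are taken into account) of integers $\ge 2$ whose sum of elements is at most $n$. For $X\in A_n$, $G(X)\in\mathcal{P}(n)$ is the multiset of all sizes different from $1$ of the Jordan cells of $X$ (with multiplicities). For $M\in\mathcal{M}_n$, $\mathcal{P}_M:=G(M)\subseteq\mathcal{P}(n)$; by conjugation invariance $M=\{X\in A_n: G(X)\in\mathcal{P}_M\}$. *)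

(* Defs.v *)
From HB Require Import structures.
From mathcomp Require Import all_boot all_order all_algebra.
From mathcomp Require Import finmap multiset.
From mathcomp Require Import boolp classical_sets.

Set Implicit Arguments.
Unset Strict Implicit.
Unset Printing Implicit Defensive.

Import GRing.Theory.
Local Open Scope ring_scope.
Local Open Scope mset_scope.
Local Open Scope classical_set_scope.

Definition nilpotent_mx (F : fieldType) (n : nat) : set 'M[F]_n :=
  [set X | exists k : nat, X ^+ k = 0].

Definition nilp_family (F : fieldType) (n : nat) : set (set 'M[F]_n) :=
  [set M | [/\ M `<=` @nilpotent_mx F n,
               M 0,
               forall g : 'M[F]_n, g \in unitmx ->
                 [set g *m X *m invmx g | X in M] = M
             & forall X Y : 'M[F]_n, M X -> M Y -> X *m Y = Y *m X ->
                 [set Z : 'M[F]_n | Z \in <<[:: X; Y]>>%VS] `<=` M]].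

Definition Pmset (n : nat) : set {mset nat} :=
  [set mu : {mset nat} | (forall m : nat, m \in mu -> (2 <= m)%N)
            /\ (\sum_(m <- mu) m <= n)%N].

Definition jordan_cell (F : fieldType) (a : F) (k : nat) : 'M[F]_k :=
  \matrix_(i, j) (a *+ (i == j) + (i.+1 == j)%:R).

Definition nilp_jordan_mx (F : fieldType) (s : seq nat) :
    'M[F]_(\sum_(i < size s) nth 0%N s i) :=
  \mxdiag_(i < size s) jordan_cell (0 : F) (nth 0%N s i).

(* [jordan_type X mu] is the graph of the map X |-> G(X) on nilpotent matrices:
   X has a Jordan normal form with cell sizes s, and mu is the multiset of the
   sizes different from 1.  A nilpotent X has 0 as its only eigenvalue, and s
   is then determined up to order by X.  The equality e is only used to view
   the block-diagonal matrix as an n x n matrix. *)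
Definition jordan_type (F : fieldType) (n : nat)
    (X : 'M[F]_n) (mu : {mset nat}) : Prop :=
  exists (s : seq nat) (e : (\sum_(i < size s) nth 0 s i)%N = n),
    [/\ all (fun k => 0 < k)%N s,
        X ~_{in unitmx} castmx (e, e) (nilp_jordan_mx F s)
      & mu = seq_mset [seq k <- s | k != 1%N]].

(* The set P_M = G(M). *)
Definition jordan_types (F : fieldType) (n : nat) (M : set 'M[F]_n) :
    set {mset nat} :=
  [set mu : {mset nat} | exists2 X : 'M[F]_n, M X & jordan_type X mu].

(* Main.v *)
Require Import Defs.
From HB Require Import structures.
From mathcomp Require Import all_boot all_order all_algebra.
From mathcomp Require Import finmap multiset.
From mathcomp Require Import boolp classical_sets.
From mathcomp Require Import fingroup perm zify.

Set Implicit Arguments.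
Unset Strict Implicit.
Unset Printing Implicit Defensive.

Local Open Scope mset_scope.
Local Open Scope classical_set_scope.

Import GRing.Theory.

(** Work with matrices supported on the superdiagonal, given by a weight
    function [w]: the entry in row [i], column [i.+1] is [w i].  A nilpotent
    Jordan matrix with cell sizes [s] is the one whose weight is the indicator
    of the predicate: [i] and [i.+1] lie in the same cell ([link s]).

    If [X] in [M] is such a Jordan matrix, rescaling the basis inside a single
    cell multiplies that cell by a scalar [a] and gives a conjugate [Y] of [X],
    for any nonzero [a].  [X] and [Y] commute, since they are proportional on
    each cell, so [(Y - X) / (a - 1)] is in [M]; it is that one cell, with
    zeros elsewhere.  The field being algebraically closed, it is infinite, and
    a scalar [a] other than 0 and 1 exists ([extract_cell], [exists_neq01]).

    Conversely, if every single cell of the required sizes is in [M], then a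
    cyclic permutation of the basis moves it to any position
    ([cell_shift]); cells in disjoint positions commute, having zero products,
    and adding them one after the other stays in [M] ([sum_cells]). *)

(** * Weighted superdiagonal matrices *)

Section WeightedShifts.
Local Open Scope ring_scope.
Variables (F : fieldType) (n : nat).
Implicit Types (u v w : nat -> F).

Definition wshift w : 'M[F]_n := \matrix_(i, j) (w i *+ (i.+1 == j)).

Lemma eq_wshift u v :
  (forall i, (i.+1 < n)%N -> u i = v i) -> wshift u = wshift v.
Proof.
move=> uv; apply/matrixP=> i j; rewrite !mxE.
by case: eqP => // ij; rewrite uv // ij ltn_ord.
Qed.

Lemma wshift_lin (a b : F) u v :
  a *: wshift u + b *: wshift v = wshift (fun i => a * u i + b * v i).
Proof. by apply/matrixP=> i j; rewrite !mxE mulrnDl !mulrnAr. Qed.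

Lemma wshift_mul u v i j :
  (wshift u *m wshift v) i j = (u i * v i.+1) *+ (i.+2 == j).
Proof.
rewrite mxE; have [lt_in | le_ni] := ltnP i.+1 n.
  rewrite (bigD1 (Ordinal lt_in)) //= !mxE eqxx mulr1n mulrnAr.
  rewrite big1 ?addr0 // => k; rewrite -val_eqE /= eq_sym => /negbTE ik.
  by rewrite !mxE ik mulr0n mul0r.
rewrite big1 => [|k _].
  by case: eqP => // ij; have := ltn_ord j; lia.
rewrite !mxE; case: eqP => [ik|_]; last by rewrite mulr0n mul0r.
by have := ltn_ord k; lia.
Qed.

Lemma wshift_comm u v :
  (forall i, u i * v i.+1 = v i * u i.+1) ->
  wshift u *m wshift v = wshift v *m wshift u.
Proof. by move=> uv; apply/matrixP=> i j; rewrite !wshift_mul uv. Qed.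

(** The conjugating matrix is diagonal: its entries [d i] are chosen with
    [d i / d i.+1 = w i], which is the factor that the entry in row [i],
    column [i.+1] acquires. *)
Lemma wshift_scale w u : (forall i, w i != 0) ->
  exists2 g : 'M[F]_n, g \in unitmx &
    g *m wshift u *m invmx g = wshift (fun i => w i * u i).
Proof.
move=> w_neq0; pose d i := (\prod_(0 <= k < i) w k)^-1.
have d_neq0 i : d i != 0.
  by rewrite invr_eq0 prodf_seq_neq0; apply/allP=> k _; rewrite w_neq0.
pose g : 'M[F]_n := diag_mx (\row_i d i).
have gU : g \in unitmx.
  rewrite unitmxE det_diag unitfE prodf_seq_neq0.
  by apply/allP=> i _; rewrite mxE d_neq0.
exists g => //; apply: (canLR (mulmxK gU)).
apply/matrixP=> i j; rewrite mul_diag_mx mul_mx_diag !mxE.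
case: eqP => [<-|_]; last by rewrite !mulr0n mulr0 mul0r.
rewrite !mulr1n; have -> : d i = w i * d i.+1.
  by rewrite /d big_nat_recr //= invfM mulrCA divff ?mulr1.
by rewrite mulrAC.
Qed.

End WeightedShifts.

(** * Positions of the cells *)

Section Cells.
Local Open Scope nat_scope.

(** The weight of a single Jordan cell of size [m] whose first row is [o], with
    zeros elsewhere. *)
Definition cell o m i := (o <= i) && (i.+1 < o + m).

(** The weight of the Jordan matrix with consecutive cells of sizes [s]: it
    vanishes at the last row of each cell and past all the cells, so that it
    also makes sense for a sum of sizes other than the dimension. *)
Fixpoint link (s : seq nat) (i : nat) : bool :=
  if s is k :: s' then (i.+1 < k) || ((k <= i) && link s' (i - k)) else false.

Lemma link_cat s1 s2 i :
  link (s1 ++ s2) i = link s1 i || ((sumn s1 <= i) && link s2 (i - sumn s1)).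
Proof.
elim: s1 i => [|k s1 IH] i /=; first by rewrite subn0.
rewrite IH -subnDA; case: (leqP k i) => ki /=; last first.
  by rewrite [k + _ <= _]leqNgt ltn_addr // ?orbF.
by rewrite leq_subRL // orbA.
Qed.

Lemma link_lt s i : link s i -> i.+1 < sumn s.
Proof.
elim: s i => //= k s IH i /orP[|/andP[ki /IH]]; lia.
Qed.

Lemma link_cell o m i : (o <= i) && link [:: m] (i - o) = cell o m i.
Proof. by rewrite /= andbF orbF /cell; lia. Qed.

(** A nilpotent cell of size 1 is the zero matrix. *)
Lemma link_ones s : [seq k <- s | k != 1] = [::] -> link s =1 xpred0.
Proof.
elim: s => //= k s IH; case: eqP => // -> /IH s0 i.
by rewrite s0 andbF.
Qed.

Lemma link_single s1 m s2 :
  [seq k <- s1 | k != 1] = [::] -> [seq k <- s2 | k != 1] = [::] ->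
  link (s1 ++ m :: s2) =1 cell (sumn s1) m.
Proof.
move=> h1 h2 i; rewrite -cat1s !link_cat !(link_ones h1) !(link_ones h2) /=.
by rewrite !andbF !orbF /cell; lia.
Qed.

Lemma filter_nseq1 k : [seq x <- nseq k 1 | x != 1] = [::].
Proof. by elim: k. Qed.

End Cells.

(** * Jordan types and single cells *)

Lemma sum_nth_sumn s : (\sum_(i < size s) nth 0 s i)%N = sumn s.
Proof. by rewrite sumnE [RHS](big_nth 0%N) big_mkord. Qed.

Lemma seq_mset1 m : seq_mset [:: m] = [mset m] :> {mset nat}.
Proof.
by apply/msetP=> x; rewrite mset_seqE msetnE /= addn0 eq_sym; case: eqP.
Qed.

Lemma seq_mset_eq1 (s : seq nat) m : [mset m] = seq_mset s -> s = [:: m].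
Proof.
move=> e; apply: perm_small_eq => //; apply/eq_seq_msetP; rewrite -e.
by rewrite seq_mset1.
Qed.

Section JordanTypes.
Local Open Scope ring_scope.
Variables (F : fieldType).

Lemma nilp_jordan_mxE s i j :
  nilp_jordan_mx F s i j = (link s i)%:R *+ (i.+1 == j).
Proof.
elim: s i j => [|k s IH] i j; first by have := ltn_ord i; rewrite {2}big_ord0.
rewrite /nilp_jordan_mx mxdiag_recl castmxE.
rewrite !mxE; case: splitP => i1 /= ->; rewrite !mxE; case: splitP => j1 /= ->.
- rewrite !mxE mul0rn add0r; case: eqP => [ij|]; rewrite ?mulr0n //.
  by rewrite ij ltn_ord.
- rewrite !mxE; case: eqP => [ij|]; rewrite ?mulr0n //=.
  have ik := ltn_ord i1; rewrite (_ : _ || _ = false) //.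
  by move: ik ij => /=; lia.
- rewrite !mxE; case: eqP => // ij; have := ltn_ord j1; rewrite /= -ij; lia.
by rewrite -addnS eqn_add2l leq_addr addKn ltnNge leq_addr -IH.
Qed.

Lemma castmx_nilp_jordan n s (e : (\sum_(i < size s) nth 0 s i)%N = n) :
  castmx (e, e) (nilp_jordan_mx F s) = wshift n (fun i => (link s i)%:R).
Proof.
by apply/matrixP=> i j; rewrite castmxE nilp_jordan_mxE !mxE.
Qed.

Variables (n : nat) (M : set 'M[F]_n).
Hypothesis hM : nilp_family M.

Lemma nilp_family_conj g X : g \in unitmx -> M X -> M (g *m X *m invmx g).
Proof.
by move=> gU MX; case: hM => _ _ conjM _; rewrite -(conjM g gU); exists X.
Qed.

Lemma nilp_family_lin a b X Y :
  M X -> M Y -> X *m Y = Y *m X -> M (a *: X + b *: Y).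
Proof.
move=> MX MY XY; case: hM => _ _ _; apply; [exact: MX|exact: MY|done|] => /=.
by rewrite rpredD // rpredZ // memv_span ?inE ?eqxx ?orbT.
Qed.

(** Conjugation invariance lets the witness in [M] be the Jordan matrix itself,
    so that the rest of the proof handles weights only. *)
Lemma jordan_typesP mu : jordan_types M mu <->
  exists s, [/\ all (fun k => 0 < k)%N s, sumn s = n,
    mu = seq_mset [seq k <- s | k != 1%N]
    & M (wshift n (fun i => (link s i)%:R))].
Proof.
split=> [[X MX [s [e [s_gt0 [P PU simX] ->]]]]|[s [s_gt0 sn -> Ms]]].
  exists s; split=> //; first by rewrite -e sum_nth_sumn.
  rewrite -(castmx_nilp_jordan e).
  move/(similarRL PU): simX => ->.
  exact: nilp_family_conj.
exists (wshift n (fun i => (link s i)%:R)) => //.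
have e : (\sum_(i < size s) nth 0 s i)%N = n by rewrite sum_nth_sumn.
exists s, e; split=> //; exists 1%:M; first exact: unitmx1.
apply/(similarRL (unitmx1 _ _)).
by rewrite invmx1 mul1mx mulmx1 castmx_nilp_jordan.
Qed.

Lemma jordan_types_single m o : (1 < m)%N -> (o + m <= n)%N ->
  M (wshift n (fun i => (cell o m i)%:R)) -> jordan_types M [mset m].
Proof.
move=> m_gt1 le_n Mm; apply/jordan_typesP.
exists (nseq o 1%N ++ m :: nseq (n - (o + m)) 1%N); split.
- by rewrite all_cat /= !all_nseq /= !orbT; lia.
- by rewrite sumn_cat /= !sumn_nseq; lia.
- by rewrite filter_cat /= !filter_nseq1 gtn_eqF // seq_mset1.
rewrite (eq_wshift (v := fun i => (cell o m i)%:R)) // => i _.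
by rewrite link_single ?filter_nseq1 // sumn_nseq mul1n.
Qed.

(** Conjugation by the permutation matrix of the rotation [i |-> i + d mod n],
    where [d] is congruent to [a - b], takes the cell at [a] to the cell at [b].
    The cells do not wrap around the end of the interval, so that the rotation
    is a translation on each of them. *)
Lemma cell_shift m a b : (0 < n)%N -> (a + m <= n)%N -> (b + m <= n)%N ->
  M (wshift n (fun i => (cell a m i)%:R)) ->
  M (wshift n (fun i => (cell b m i)%:R)).
Proof.
move=> n_gt0 le_an le_bn Ma.
have [d d_le dE] : exists2 d, (d <= n)%N & d = (a - b)%N /\ (b <= a)%N
    \/ d = (n - (b - a))%N /\ (a < b)%N.
  case: (leqP b a) => ba; first by exists (a - b)%N; [lia | left].
  by exists (n - (b - a))%N; [lia | right].
pose f (i : 'I_n) := Ordinal (ltn_pmod (i + d) n_gt0).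
have f_inj : injective f.
  move=> i j /(congr1 val)/eqP /=; rewrite eqn_modDr !modn_small // => /eqP.
  exact: val_inj.
have fE (i : 'I_n) : f i = (if i + d < n then i + d else i + d - n)%N :> nat.
  rewrite /=; case: ltnP => h; first by rewrite modn_small.
  rewrite -[in LHS](subnK h) modnDr modn_small //.
  by have := ltn_ord i; lia.
pose s := perm f_inj.
have := nilp_family_conj (unitmx_perm _ s) Ma.
have -> X : perm_mx s *m X *m invmx (perm_mx s) = row_perm s (col_perm s X).
  apply: (canLR (mulmxK (unitmx_perm _ s))).
  by rewrite row_permE col_permE -!mulmxA -perm_mxM mulVg perm_mx1 mulmx1.
congr (M _); apply/matrixP=> i j; rewrite !mxE !permE.
rewrite -!mulrnA; congr (_ *+ _).
rewrite !mulnb; congr nat_of_bool.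
have := fE i; have := fE j; move: (f i : nat) (f j : nat) => fi fj.
have := ltn_ord i; have := ltn_ord j; rewrite /cell.
case: (ltnP (i + d) n) => ? ? ?; case: (ltnP (j + d) n) => ? -> ->;
  by case: dE => -[? ?]; apply/idP/idP => /andP[/andP[? ?] /eqP ?]; lia.
Qed.

End JordanTypes.

(** * Splitting into cells and reassembling *)

Section Cutting.
Local Open Scope ring_scope.
Variables (F : fieldType) (n : nat) (M : set 'M[F]_n).
Hypotheses (n_gt0 : (0 < n)%N) (hM : nilp_family M).

(** A member of [M] of type [{m}] has its nontrivial cell at some position among
    cells of size 1; shifting that cell reaches every other position. *)
Lemma single_cell m o : jordan_types M [mset m] -> (o + m <= n)%N ->
  M (wshift n (fun i => (cell o m i)%:R)).
Proof.
move=> /(jordan_typesP hM) [s [_ sn /seq_mset_eq1 sm Ms]] le_n.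
have [m1 ms] : m != 1%N /\ m \in s.
  by apply/andP; rewrite -(mem_filter (fun k => k != 1%N)) sm mem_head.
case/splitPr: ms sn sm Ms => s1 s2 sn sm Ms.
have [h1 h2] : [seq k <- s1 | k != 1%N] = [::] /\
    [seq k <- s2 | k != 1%N] = [::].
  have := congr1 size sm; rewrite filter_cat /= m1 size_cat /= => h.
  by split; apply/nilP; rewrite /nilp; lia.
apply: (cell_shift hM (a := sumn s1)) => //.
  by rewrite -sn sumn_cat /= addnA leq_addr.
rewrite (eq_wshift (v := fun i => (link (s1 ++ m :: s2) i)%:R)) // => i _.
by rewrite link_single.
Qed.

(** The induction adds the last cell to the sum of the earlier ones; the
    weights of the two have disjoint supports, and the supports are separated
    enough for the products to vanish. *)
Lemma sum_cells s : (sumn s <= n)%N ->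
  (forall m, m \in s -> m != 1%N -> jordan_types M [mset m]) ->
  M (wshift n (fun i => (link s i)%:R)).
Proof.
elim/last_ind: s => [|s m IH] sn Ms.
  have -> : wshift n (fun i => (link [::] i)%:R : F) = 0.
    by apply/matrixP=> i j; rewrite !mxE mul0rn.
  by case: hM.
rewrite -cats1 sumn_cat /= addn0 in sn.
have {}IH : M (wshift n (fun i => (link s i)%:R)).
  apply: IH => [|k ks]; first by lia.
  by apply: Ms; rewrite mem_rcons inE ks orbT.
have [m1|m1] := eqVneq m 1%N.
  rewrite (eq_wshift (v := fun i => (link s i)%:R)) // => i _.
  by rewrite -cats1 link_cat m1 /= !andbF orbF.
have Mm := single_cell (Ms m _ m1) sn.
rewrite (eq_wshift (v := fun i => 1 * (link s i)%:R
    + 1 * (cell (sumn s) m i)%:R)); last first.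
  move=> i _; rewrite -cats1 link_cat link_cell !mul1r.
  case: (boolP (link s i)) => [/link_lt h|_]; last by rewrite add0r.
  have -> : cell (sumn s) m i = false by rewrite /cell; lia.
  by rewrite addr0.
rewrite -wshift_lin; apply: nilp_family_lin => //.
  by apply: Mm; rewrite mem_rcons inE eqxx.
apply: wshift_comm => i; rewrite -!natrM !mulnb; congr (nat_of_bool _)%:R.
transitivity false; [|symmetry]; apply/negP => /andP[].
  by move=> /link_lt h; rewrite /cell; lia.
by move=> h /link_lt; move: h; rewrite /cell; lia.
Qed.

(** The matrix minus its conjugate scaled by [a] on the middle cell is zero
    outside that cell. *)
Lemma extract_cell (a : F) s1 m s2 : a != 0 -> a != 1 ->
  M (wshift n (fun i => (link (s1 ++ m :: s2) i)%:R)) ->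
  M (wshift n (fun i => (cell (sumn s1) m i)%:R)).
Proof.
move=> a0 a1 Ms; set o := sumn s1; set L := link _ in Ms.
pose w i := if (o <= i < o + m)%N then a else 1.
have w0 i : w i != 0 by rewrite /w; case: ifP; rewrite ?oner_neq0.
have [g gU gE] := wshift_scale n (fun i => (L i)%:R) w0.
have Mw : M (wshift n (fun i => w i * (L i)%:R)).
  by rewrite -gE; apply: nilp_family_conj.
have LE i : L i = [|| link s1 i, cell o m i |
    (o + m <= i)%N && link s2 (i - (o + m))].
  rewrite /L -cat1s !link_cat /= addn0 /cell -/o.
  by rewrite andbF orbF -subnDA; lia.
(* [w] is constant on every cell, which is what makes the matrices commute. *)
have wL i : L i -> w i = w i.+1.
  move=> Li; rewrite /w.
  suff -> : (o <= i < o + m)%N = (o <= i.+1 < o + m)%N by [].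
  move: Li; rewrite LE => /or3P[/link_lt|/andP[]|/andP[? _]]; rewrite -/o; lia.
have comm : wshift n (fun i => (L i)%:R) *m wshift n (fun i => w i * (L i)%:R)
    = wshift n (fun i => w i * (L i)%:R) *m wshift n (fun i => (L i)%:R).
  apply: wshift_comm => i.
  case: (boolP (L i)) => [/wL ->|_]; last by rewrite mulr0 !mul0r.
  by rewrite mulr1 mul1r.
have := nilp_family_lin hM (- (a - 1)^-1) (a - 1)^-1 Ms Mw comm.
rewrite wshift_lin; congr (M _); apply: eq_wshift => i _.
rewrite mulNr addrC -mulrBr -{2}[(L i)%:R]mul1r -mulrBl mulrA /w.
case: ifP => h; last first.
  by rewrite subrr mulr0 mul0r (_ : cell o m i = false) // /cell; lia.
rewrite mulVf ?subr_eq0 // mul1r; congr (nat_of_bool _)%:R.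
rewrite LE; case: (boolP (link s1 i)) => [/link_lt|_] /=; first by lia.
by rewrite leqNgt; case/andP: h => _ ->; rewrite orbF.
Qed.

End Cutting.

(** An algebraically closed field is infinite, so [X (X - 1)] has a nonroot. *)
Lemma exists_neq01 (F : closedFieldType) : exists a : F, (a != 0 /\ a != 1)%R.
Proof.
have p0 : ('X * ('X - 1%:P) : {poly F})%R != 0%R.
  by rewrite mulf_neq0 ?polyX_eq0 ?polyXsubC_eq0.
have /PreClosedField.closed_nonrootP := p0.
move=> /(_ (@solve_monicpoly F))[a]; rewrite rootM rootX root_XsubC negb_or.
by case/andP; exists a.
Qed.

Theorem corollary3p1 (F : closedFieldType) (n : nat) (n_gt0 : (0 < n)%N)
    (M : set 'M[F]_n) (hM : @nilp_family F n M)
    (mu : {mset nat}) (hmu : Pmset n mu) :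
  jordan_types M mu <-> (forall m : nat, m \in mu -> jordan_types M [mset m]).
Proof.
have [mu_ge2 mu_le] := hmu.
split=> [/(jordan_typesP hM) [s [_ sn mus Ms]] m m_mu|mu1].
  have ms : m \in s.
    move: (m_mu); rewrite mus (perm_mem (perm_eq_seq_mset _)).
    by rewrite mem_filter => /andP[].
  case/splitPr: ms sn {mus} Ms => s1 s2 sn Ms.
  have [a [a0 a1]] := exists_neq01 F.
  apply: (jordan_types_single hM (mu_ge2 m m_mu) (o := sumn s1)).
    by rewrite -sn sumn_cat /= addnA leq_addr.
  exact: extract_cell a0 a1 Ms.
have mu_sum : (sumn mu <= n)%N by rewrite sumnE.
apply/(jordan_typesP hM); exists (mu ++ nseq (n - sumn mu) 1%N); split.
- rewrite all_cat all_nseq orbT andbT; apply/allP=> m m_mu.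
  by have := mu_ge2 m m_mu; lia.
- by rewrite sumn_cat sumn_nseq mul1n subnKC.
- rewrite filter_cat filter_nseq1 cats0 -[LHS]seq_mset_id; congr seq_mset.
  symmetry; apply/all_filterP/allP=> m m_mu.
  by have := mu_ge2 m m_mu; lia.
apply: sum_cells => // [|m].
  by rewrite sumn_cat sumn_nseq mul1n subnKC.
rewrite mem_cat => /orP[m_mu _|]; first exact: mu1.
by rewrite mem_nseq => /andP[_ ->].
Qed.
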